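(* Let $\mathbb K$ be a field of characteristic $0$ and let $V$ be a vector space over $\mathbb K$ of positive finite dimension. Let $(A,A^* )$, $(B,B^* )$ and $(C,C^* )$ be three mutually adjacent Leonard pairs on $V$. Then for each of these pairs, the eigenvalue sequences and the dual eigenvalue sequences are arithmetic.
   Context: A square matrix is tridiagonal if each nonzero entry lies on the diagonal, subdiagonal or superdiagonal; a tridiagonal matrix is irreducible if all its subdiagonal entries and all its superdiagonal entries are nonzero. A square matrix is lower bidiagonal if each nonzero entry lies on the diagonal or the subdiagonal, and upper bidiagonal if its transpose is lower bidiagonal. Bases are ordered. A Leonard pair on $V$ is an ordered pair $(A,A^* )$ of linear maps $A,A^*:V\to V$ such that (i) there is a basis of $V$ with respect to which $A$ is diagonal and $A^*$ is irreducible tridiagonal, and (ii) there is a basis of $V$ with respect to which $A^*$ is diagonal and $A$ is irreducible tridiagonal. ($A^*$ is just a name; no adjoint is meant.) A basis as in (i) is called $A$-standard, a basis as in (ii) is called $A^*$-standard, and a basis is standard for $(A,A^* )$ if it is $A$-standard or $A^*$-standard. A basis is split for $(A,A^* )$ if with respect to it one of $A,A^*$ is lower bidiagonal and the other is upper bidiagonal. Leonard pairs $(A,A^* )$ and $(B,B^* )$ on $V$ are adjacent if every basis that is standard for $(A,A^* )$ is split for $(B,B^* )$ and every basis that is standard for $(B,B^* )$ is split for $(A,A^* )$. Leonard pairs are mutually adjacent if any two of them are adjacent. Let $d=\dim V-1$. If $v_0,\dots,v_d$ is an $A$-standard basis and $Av_i=\theta_iv_i$ for $0\le i\le d$, then $\theta_0,\dots,\theta_d$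 is called an eigenvalue sequence for $(A,A^* )$. If $v_0^*,\dots,v_d^*$ is an $A^*$-standard basis and $A^*v_i^*=\theta_i^*v_i^*$ for $0\le i\le d$, then $\theta_0^*,\dots,\theta_d^*$ is called a dual eigenvalue sequence for $(A,A^* )$. A sequence $\theta_0,\dots,\theta_d$ of mutually distinct scalars of $\mathbb K$ is arithmetic if there are $\alpha,\beta\in\mathbb K$ with $\alpha\ne0$ and $\theta_i=\alpha i+\beta$ for $0\le i\le d$. *)

(* Defs.v *)
From HB Require Import structures.
From mathcomp Require Import all_boot all_order all_algebra.

Set Implicit Arguments.
Unset Strict Implicit.
Unset Printing Implicit Defensive.

Import GRing.Theory.
Local Open Scope ring_scope.

Section MatrixShapes.
Variables (K : fieldType) (n : nat).
Implicit Type M : 'M[K]_n.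

Definition tridiagonal M : Prop :=
  forall i j : 'I_n, M i j != 0 ->
    [\/ i = j :> nat, i = j.+1 :> nat | j = i.+1 :> nat].

Definition irreducible_tridiagonal M : Prop :=
  [/\ tridiagonal M,
      forall i j : 'I_n, i = j.+1 :> nat -> M i j != 0
    & forall i j : 'I_n, j = i.+1 :> nat -> M i j != 0].

Definition lower_bidiagonal M : Prop :=
  forall i j : 'I_n, M i j != 0 -> i = j :> nat \/ i = j.+1 :> nat.

Definition upper_bidiagonal M : Prop := lower_bidiagonal M^T.

Definition arithmetic (theta : 'I_n -> K) : Prop :=
  injective theta /\
  exists alpha beta : K,
    alpha != 0 /\ forall i : 'I_n, theta i = alpha * i%:R + beta.

End MatrixShapes.

Section LeonardPairs.
Variables (K : fieldType) (V : vectType K).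
Implicit Types (A : 'End(V)) (P Q : 'End(V) * 'End(V)).
Implicit Type X : (\dim {:V}).-tuple V.

(* [passmx.mxof] acts on row vectors; the transpose gives the matrix M with
   A (X_j) = \sum_i M i j *: X_i. *)
Definition rep_mx X A : 'M[K]_(\dim {:V}) := (passmx.mxof X X A)^T.

(* The basis X is A-standard for the pair P = (A, As); [snd_standard] below is
   As-standard. *)
Definition fst_standard P X : Prop :=
  [/\ basis_of fullv X, is_diag_mx (rep_mx X P.1)
    & irreducible_tridiagonal (rep_mx X P.2)].

Definition snd_standard P X : Prop :=
  [/\ basis_of fullv X, is_diag_mx (rep_mx X P.2)
    & irreducible_tridiagonal (rep_mx X P.1)].

Definition Leonard_pair P : Prop :=
  (exists X, fst_standard P X) /\ (exists X, snd_standard P X).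

Definition standard P X : Prop := fst_standard P X \/ snd_standard P X.

Definition split_basis P X : Prop :=
  basis_of fullv X /\
  (lower_bidiagonal (rep_mx X P.1) /\ upper_bidiagonal (rep_mx X P.2) \/
   lower_bidiagonal (rep_mx X P.2) /\ upper_bidiagonal (rep_mx X P.1)).

Definition adjacent P Q : Prop :=
  (forall X, standard P X -> split_basis Q X) /\
  (forall X, standard Q X -> split_basis P X).

Definition eigenvalue_seq P (theta : 'I_(\dim {:V}) -> K) : Prop :=
  exists2 X, fst_standard P X &
    forall i, P.1 (tnth X i) = theta i *: tnth X i.

Definition dual_eigenvalue_seq P (theta : 'I_(\dim {:V}) -> K) : Prop :=
  exists2 X, snd_standard P X &
    forall i, P.2 (tnth X i) = theta i *: tnth X i.

End LeonardPairs.

(* Main.v *)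
(** An A-standard basis X is split for the other two pairs, and after swapping
    B with Bs and C with Cs the flag spanned by the final segments of X is also
    the flag of a B-standard basis Y and of a C-standard basis Z, up to reversing
    Y and Z.  On each three-dimensional subquotient of this flag, A, B and C act
    as diagonalizable maps, each lower bidiagonal in the eigenbases of the others,
    and this forces the ratios of consecutive eigenvalue gaps of any two of them
    to be inverse to each other.  Three ratios that are pairwise inverse are all
    1 or all -1, and -1 would give two equal eigenvalues. *)

Require Import Defs.
From HB Require Import structures.
From mathcomp Require Import all_boot all_order all_algebra.
From mathcomp Require Import zify ring.

Set Implicit Arguments.
Unset Strict Implicit.
Unset Printing Implicit Defensive.

Import GRing.Theory.
Local Open Scope ring_scope.

(** * Preliminaries: sums with few nonzero terms, and integer sequences with unit steps *)

Section FiniteSums.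
Variables (K : fieldType) (n : nat).
Implicit Type F : 'I_n -> K.

Lemma sum_supp1 F i : (forall k, k != i -> F k = 0) -> \sum_k F k = F i.
Proof. by move=> F0; rewrite (bigD1 i) //= big1 ?addr0. Qed.

Lemma sum_supp2 F i j : i != j -> (forall k, k != i -> k != j -> F k = 0) ->
  \sum_k F k = F i + F j.
Proof.
move=> ij F0; rewrite (bigD1 i) //= (bigD1 j) ?big1 /= ?addr0 //.
  by move=> k /andP[]; exact: F0.
by rewrite eq_sym.
Qed.

End FiniteSums.

(** Injectivity forbids turning back, since a turn at [i.+1] would give [f i.+2 = f i]. So the first
    step fixes the direction of all the others, and the range from 0 to [d] then fixes [f 0]. *)
Lemma nat_unit_steps_monotone d (f : nat -> nat) :
  (forall i j, (i <= d)%N -> (j <= d)%N -> f i = f j -> i = j) ->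
  (forall i, (i <= d)%N -> (f i <= d)%N) ->
  (forall i, (i < d)%N -> (f i <= (f i.+1).+1)%N /\ (f i.+1 <= (f i).+1)%N) ->
  (forall i, (i <= d)%N -> f i = i) \/ (forall i, (i <= d)%N -> f i = (d - i)%N).
Proof.
move=> f_inj f_le f_step.
have step i : (i < d)%N -> f i.+1 = (f i).+1 \/ f i = (f i.+1).+1.
  move=> id; have := f_step i id; have := f_inj i i.+1; lia.
have turn i : (i.+1 < d)%N -> f i.+2 <> f i.
  by move=> id; have := f_inj i.+2 i; lia.
case: d => [|d] in f_inj f_le f_step step turn *.
  by left=> i; have := f_le i; lia.
have [up|down] := step 0%N isT.
  have ups i : (i < d.+1)%N -> f i.+1 = (f i).+1.
    elim: i => // i IH id; have := step i.+1 id; have := turn i id.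
    by have := IH (ltnW id); lia.
  have fE i : (i <= d.+1)%N -> f i = (f 0 + i)%N.
    elim: i => [|i IH] id; first by rewrite addn0.
    by rewrite ups // IH; lia.
  by left=> i id; have := fE i id; have := fE d.+1 (leqnn _); have := f_le d.+1 (leqnn _); lia.
have downs i : (i < d.+1)%N -> f i = (f i.+1).+1.
  elim: i => // i IH id; have := step i.+1 id; have := turn i id.
  by have := IH (ltnW id); lia.
have fE i : (i <= d.+1)%N -> f 0%N = (f i + i)%N.
  elim: i => [|i IH] id; first by rewrite addn0.
  by have := downs i id; have := IH (ltnW id); lia.
by right=> i id; have := fE i id; have := fE d.+1 (leqnn _); have := f_le 0%N isT; lia.
Qed.

(** * Bidiagonal, tridiagonal and lower triangular matrices *)

Section BandMatrices.
Variables (K : fieldType) (n : nat).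
Implicit Types (i j k : 'I_n) (M L U D R S T : 'M[K]_n).

Lemma lower_bidiagonal_eq0 L i j : lower_bidiagonal L ->
  i <> j :> nat -> i <> j.+1 :> nat -> L i j = 0.
Proof. by move=> hL ij ij1; apply/eqP/negPn/negP => /hL[]. Qed.

Lemma upper_bidiagonal_eq0 U i j : upper_bidiagonal U ->
  i <> j :> nat -> j <> i.+1 :> nat -> U i j = 0.
Proof.
move=> hU ij ij1; have := @lower_bidiagonal_eq0 U^T j i hU; rewrite mxE.
by apply=> // /esym.
Qed.

Lemma tridiagonal_eq0 R i j : tridiagonal R ->
  i <> j :> nat -> i <> j.+1 :> nat -> j <> i.+1 :> nat -> R i j = 0.
Proof. by move=> hR ij ij1 ji1; apply/eqP/negPn/negP => /hR[]. Qed.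

Lemma diag_mx_eq0 D i j : is_diag_mx D -> i != j -> D i j = 0.
Proof. by move=> /is_diag_mxP hD; exact: hD. Qed.

Lemma mulmx_diagr M D i j : is_diag_mx D -> (M *m D) i j = M i j * D j j.
Proof.
move=> hD; rewrite mxE (sum_supp1 (i := j)) // => k kj.
by rewrite (diag_mx_eq0 hD kj) mulr0.
Qed.

Lemma mulmx_diagl M D i j : is_diag_mx D -> (D *m M) i j = D i i * M i j.
Proof.
move=> hD; rewrite mxE (sum_supp1 (i := i)) // => k ki.
by rewrite (diag_mx_eq0 hD) ?mul0r // eq_sym.
Qed.

Lemma trig_mx_eq0 T i j : is_trig_mx T -> (i < j)%N -> T i j = 0.
Proof. by move=> /is_trig_mxP hT; exact: hT. Qed.

Lemma trig_unitmx_diag_neq0 T i : is_trig_mx T -> T \in unitmx -> T i i != 0.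
Proof.
move=> hT; rewrite unitmxE det_trig // unitfE.
by move/prodf_neq0 => /(_ i isT).
Qed.

Lemma mulmx_trig S T : is_trig_mx S -> is_trig_mx T -> is_trig_mx (S *m T).
Proof.
move=> hS hT; apply/is_trig_mxP => i j ij; rewrite mxE big1 // => k _.
have [ik|ki] := ltnP i k; first by rewrite (trig_mx_eq0 hS ik) mul0r.
by rewrite (trig_mx_eq0 hT (leq_ltn_trans ki ij)) mulr0.
Qed.

(** Induction on the row: once the entries of column [j] of [S] above row [i] vanish, the entry
    [(i,j)] of [T *m S] reduces to [T i i * S i j], and [T i i] is nonzero. *)
Lemma trig_mx_inverse S T : is_trig_mx T -> T *m S = 1%:M -> is_trig_mx S.
Proof.
move=> hT TS; apply/is_trig_mxP => i j.
have hTu : T \in unitmx by have [] := mulmx1_unit TS.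
elim/ltn_ind: {i}(i : nat) {-2}i (erefl (i : nat)) => m IH i im ij.
have := congr1 (fun M : 'M_n => M i j) TS; rewrite !mxE.
rewrite (sum_supp1 (i := i)) => [|k ki]; last first.
  have [ik|ik] := ltnP i k; first by rewrite (trig_mx_eq0 hT ik) mul0r.
  move: ki; rewrite -val_eqE /= => ki.
  by rewrite (IH k _ k) ?mulr0 //; lia.
have -> : (i == j) = false by rewrite -val_eqE /=; lia.
by move/eqP; rewrite mulf_eq0 (negPf (trig_unitmx_diag_neq0 i hT hTu)) => /eqP.
Qed.

(** The rows of the eigenvalue equation form a three-term recurrence. Since the superdiagonal is
    nonzero, each coordinate of [v] is determined by the earlier ones. *)
Lemma irreducible_tridiagonal_eigenvector0 R (v : 'cV_n) c (o : 'I_n) :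
  irreducible_tridiagonal R -> R *m v = c *: v ->
  o = 0%N :> nat -> v o ord0 = 0 -> v = 0.
Proof.
case=> hR _ hRu Rv o0 vo; apply/colP => k; rewrite [RHS]mxE.
elim/ltn_ind: {k}(k : nat) {-2}k (erefl (k : nat)) => m IH k km.
case: m => [|m] in IH km *.
  by rewrite -[RHS]vo; congr (v _ _); apply: val_inj; rewrite /= o0.
have mn : (m < n)%N by have := ltn_ord k; lia.
pose p := Ordinal mn.
have := congr1 (fun M : 'cV_n => M p ord0) Rv.
rewrite mxE [RHS]mxE (IH m _ p) // mulr0 (sum_supp1 (i := k)).
  by move/eqP; rewrite mulf_eq0 (negPf (hRu p k _)) //= => /eqP.
move=> l; rewrite -val_eqE /= => lk.
have [lm|ml] := leqP l m; first by rewrite (IH l _ l) ?mulr0.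
by rewrite (tridiagonal_eq0 hR) ?mul0r //=; lia.
Qed.

Lemma col_mulmx M S k : col k (M *m S) = M *m col k S.
Proof. by rewrite !colE mulmxA. Qed.

(* An eigenvector of an irreducible tridiagonal matrix is determined by its
   first coordinate, so no eigenvalue can be repeated. *)
Lemma irreducible_tridiagonal_simple R S D : irreducible_tridiagonal R ->
  S \in unitmx -> is_diag_mx D -> R *m S = S *m D ->
  injective (fun i => D i i).
Proof.
move=> hR hS hD RS i j Dij; apply/eqP/negPn/negP => ij.
have n0 : (0 < n)%N by apply: leq_ltn_trans (ltn_ord i).
pose o : 'I_n := Ordinal n0.
have Rcol k : R *m col k S = D k k *: col k S.
  by rewrite -col_mulmx RS; apply/colP => l; rewrite mxE mulmx_diagr // !mxE mulrC.
have col_inv a b : a *: col i S = b *: col j S -> a = 0 /\ b = 0.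
  move=> /(congr1 (mulmx (invmx S))); rewrite -!scalemxAr -!col_mulmx mulVmx //.
  move=> e; split.
    have := congr1 (fun M : 'cV_n => M i ord0) e.
    by rewrite !mxE eqxx (negPf ij) mulr1 mulr0.
  have := congr1 (fun M : 'cV_n => M j ord0) e.
  by rewrite !mxE eqxx eq_sym (negPf ij) mulr1 mulr0.
have Soj : S o j = 0.
  (* If the eigenvalues agree, this combination is again an eigenvector, with first coordinate 0, so
     it vanishes. Independence of the two columns then kills its coefficient [S o j]. *)
  pose v := S o j *: col i S - S o i *: col j S.
  have /subr0_eq : v = 0.
    apply: (irreducible_tridiagonal_eigenvector0 (c := D i i) (o := o) hR) => //.
      rewrite mulmxBr -!scalemxAr !Rcol Dij scalerBr !scalerA.
      by rewrite ![D j j * _]mulrC.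
    by rewrite !mxE mulrC subrr.
  by move/col_inv => [].
have Sj : col j S = 0.
  apply: (irreducible_tridiagonal_eigenvector0 (o := o) hR (Rcol j)) => //.
  by rewrite mxE.
have [_ /eqP] : 0 = 0 :> K /\ 1 = 0 :> K.
  by apply: col_inv; rewrite Sj scaler0 scale0r.
by rewrite oner_eq0.
Qed.

(* Let m j be the position of the first nonzero entry in column j of T.  The
   eigenvalues being distinct, m is injective, and since U moves first nonzero
   positions up by at most one while R couples all neighbours, m j and m j.+1
   differ by at most one; hence m is the identity or the reversal. *)
Lemma split_basis_alignment L U D R T : T \in unitmx ->
  lower_bidiagonal L -> upper_bidiagonal U -> is_diag_mx D ->
  injective (fun i => D i i) -> irreducible_tridiagonal R ->
  L *m T = T *m D -> U *m T = T *m R ->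
  is_trig_mx T \/ (forall i j, (i < rev_ord j)%N -> T i j = 0).
Proof.
move=> hT hL hU hD D_inj [hR hRl hRu] LT UT.
have ex_first j : exists i, T i j != 0 /\ forall i' : 'I_n, (i' < i)%N -> T i' j = 0.
  have [i Tij|T0] := pickP (fun i => T i j != 0).
    have [i1 Ti1 i1_min] := @arg_minnP _ i (fun i => T i j != 0) (fun i => i : nat) Tij.
    exists i1; split=> // i'; apply: contraTeq => /i1_min.
    by rewrite -leqNgt.
  have : invmx T *m col j T = delta_mx j ord0.
    by rewrite -col_mulmx mulVmx // colE mul1mx.
  have -> : col j T = 0 by apply/colP => i; rewrite !mxE; apply/eqP/negbFE/T0.
  rewrite mulmx0 => /colP/(_ j); rewrite !mxE !eqxx => /eqP.
  by rewrite eq_sym oner_eq0.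
have [m mP] := fin_all_exists ex_first.
(* In row [m j], [L] sees only the entries of column [j] of [T] at positions [m j] and just above,
   and the latter is 0. *)
have eigE j : D j j = L (m j) (m j).
  have [Tm T0] := mP j.
  have := congr1 (fun M : 'M_n => M (m j) j) LT.
  rewrite (mulmx_diagr _ _ _ hD) mxE (sum_supp1 (i := m j)) => [|k].
    by rewrite mulrC => /(mulfI Tm) ->.
  rewrite -val_eqE /= => kj.
  have [km|mk] := ltnP k (m j); first by rewrite T0 ?mulr0.
  by rewrite (lower_bidiagonal_eq0 hL) ?mul0r //; lia.
have m_inj : injective m by move=> i j mij; apply: D_inj; rewrite /= !eigE mij.
have m_step j k : R k j != 0 -> (m j <= (m k).+1)%N.
  move=> Rkj.
  (* Among the columns coupled to [j] by [R], take the one whose first nonzero entry is highest. By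
     injectivity of [m] it alone contributes to the entry [(m l, j)] of [T *m R]. If [m j] exceeded
     [m l] by more than one, that entry of [U *m T] would be 0. *)
  have [l Rlj l_min] := @arg_minnP _ k (fun k => R k j != 0) (fun k => m k : nat) Rkj.
  apply: (leq_trans _ (l_min k Rkj : (m l < (m k).+1)%N)).
  rewrite leqNgt; apply/negP => lt_m.
  have := congr1 (fun M : 'M_n => M (m l) j) UT.
  rewrite mxE big1 => [|i _]; last first.
    have [im|mi] := ltnP i (m j); first by rewrite (mP j).2 ?mulr0.
    by rewrite (upper_bidiagonal_eq0 hU) ?mul0r //; lia.
  rewrite mxE (sum_supp1 (i := l)) => [/esym/eqP|i il].
    by rewrite mulf_eq0 (negPf (mP l).1) (negPf Rlj).
  have [->|Rij] := eqVneq (R i j) 0; first by rewrite mulr0.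
  rewrite (mP i).2 ?mul0r // ltn_neqAle l_min // andbT.
  by apply: contra il => /eqP/val_inj/m_inj ->.
case: n => [|d] in L U D R T hT hL hU hD D_inj hR hRl hRu LT UT ex_first m mP eigE m_inj m_step *.
  by left; apply/is_trig_mxP => -[].
have mi_inj (i j : nat) : (i <= d)%N -> (j <= d)%N ->
    m (inord i) = m (inord j) :> nat -> i = j.
  by move=> id jd /val_inj/m_inj/(congr1 val); rewrite /= !inordK.
have m_le (i : nat) : (i <= d)%N -> (m (inord i) <= d)%N by move=> _; rewrite -ltnS.
have mi_step (i : nat) : (i < d)%N ->
    (m (inord i) <= (m (inord i.+1)).+1)%N /\ (m (inord i.+1) <= (m (inord i)).+1)%N.
  by move=> id; split; apply: m_step; [apply: hRl|apply: hRu]; rewrite !inordK //; lia.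
have [mE|mE] := nat_unit_steps_monotone mi_inj m_le mi_step; [left; apply/is_trig_mxP|right] => i j ij;
  apply: (mP j).2; have := mE j (ltn_ord j); rewrite inord_val => -> //.
Qed.

(** A zero at [(q,p)] would make [L], and with it [T], block diagonal with a cut between [p] and
    [q]. Then [U *m T] vanishes at [(q,p)], whereas [T *m R] has the nonzero entry [T q q * R q p]
    there. *)
Lemma split_trig_subdiagonal_neq0 L U D R T (p q : 'I_n) : T \in unitmx -> is_trig_mx T ->
  lower_bidiagonal L -> upper_bidiagonal U -> is_diag_mx D ->
  injective (fun i => D i i) -> irreducible_tridiagonal R ->
  L *m T = T *m D -> U *m T = T *m R -> q = p.+1 :> nat -> T q p != 0.
Proof.
move=> hT tT hL hU hD D_inj [hR hRl hRu] LT UT qp; apply/negP => /eqP Tqp.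
have T_neq0 i := trig_unitmx_diag_neq0 i tT hT.
have LTE i k : (L *m T) i k = T i k * D k k by rewrite LT (mulmx_diagr _ _ _ hD).
have L_diag i : L i i = D i i.
  have := LTE i i; rewrite mxE (sum_supp1 (i := i)) => [|k].
    by rewrite mulrC => /(mulfI (T_neq0 i)).
  rewrite -val_eqE /= => ki.
  have [lt_ki|le_ik] := ltnP i k; first by rewrite (lower_bidiagonal_eq0 hL) ?mul0r //; lia.
  by rewrite (trig_mx_eq0 tT) ?mulr0 //; lia.
have Lqp : L q p = 0.
  have := LTE q p; rewrite Tqp mul0r mxE (sum_supp1 (i := p)) => [/eqP|k].
    by rewrite mulf_eq0 (negPf (T_neq0 p)) orbF => /eqP.
  rewrite -val_eqE /= => kp.
  have [->|] := eqVneq k q; first by rewrite Tqp mulr0.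
  rewrite -val_eqE /= => kq.
  by rewrite (lower_bidiagonal_eq0 hL) ?mul0r //; lia.
(* Since [L q p = 0], rows of [L] beyond [p] do not reach back to [p]. Induction on the row leaves
   [(D i i - D k k) * T i k = 0], with distinct eigenvalues. *)
have T0 i k : (k <= p)%N -> (p < i)%N -> T i k = 0.
  elim/ltn_ind: {i}(i : nat) {-2}i (erefl (i : nat)) => m IH i im kp pm.
  have := LTE i k; rewrite mxE (sum_supp1 (i := i)) => [|l].
    rewrite L_diag => e; have /eqP : (D i i - D k k) * T i k = 0 by rewrite mulrBl e; ring.
    rewrite mulf_eq0 => /orP[/eqP/subr0_eq/D_inj ik|/eqP //].
    by have := congr1 val ik; rewrite /= ; lia.
  rewrite -val_eqE /= => li.
  have [pl|lp] := ltnP p l; last first.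
    have [->|lp'] := eqVneq l p; last first.
      by move: lp'; rewrite -val_eqE /= => lp'; rewrite (lower_bidiagonal_eq0 hL) ?mul0r //; lia.
    have [->|iq] := eqVneq i q; first by rewrite Lqp mul0r.
    by move: iq; rewrite -val_eqE /= => iq; rewrite (lower_bidiagonal_eq0 hL) ?mul0r //; lia.
  have [lt_li|le_il] := ltnP l i; first by rewrite (IH l _ l) ?mulr0 // -im.
  by rewrite (lower_bidiagonal_eq0 hL) ?mul0r //; lia.
have := congr1 (fun M : 'M_n => M q p) UT.
rewrite mxE big1 => [|k _]; last first.
  have [pk|kp] := ltnP p k; first by rewrite T0 ?mulr0.
  by rewrite (upper_bidiagonal_eq0 hU) ?mul0r //; lia.
rewrite mxE (sum_supp1 (i := q)) => [/esym/eqP|k].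
  by rewrite mulf_eq0 (negPf (T_neq0 q)) (negPf (hRl _ _ qp)).
rewrite -val_eqE /= => kq.
have [kp|pk] := leqP k p; first by rewrite T0 ?mul0r //; lia.
by rewrite (trig_mx_eq0 tT) ?mul0r //; lia.
Qed.

(** [L *m T] is lower triangular, but the entry [(p,q)] of [T *m R] is [T p p * R p q], which is
    nonzero. *)
Lemma trig_not_lower_bidiagonal L R T (p q : 'I_n) : T \in unitmx -> is_trig_mx T ->
  lower_bidiagonal L -> irreducible_tridiagonal R -> L *m T = T *m R ->
  q = p.+1 :> nat -> False.
Proof.
move=> hT tT hL [hR _ hRu] LT qp.
have := congr1 (fun M : 'M_n => M p q) LT.
rewrite mxE big1 => [|k _]; last first.
  have [kq|qk] := ltnP k q; first by rewrite (trig_mx_eq0 tT) ?mulr0.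
  by rewrite (lower_bidiagonal_eq0 hL) ?mul0r //; lia.
rewrite mxE (sum_supp1 (i := p)) => [/esym/eqP|k].
  by rewrite mulf_eq0 (negPf (trig_unitmx_diag_neq0 p tT hT)) (negPf (hRu _ _ qp)).
rewrite -val_eqE /= => kp.
have [lt_pk|le_kp] := ltnP p k; first by rewrite (trig_mx_eq0 tT) ?mul0r.
by rewrite (tridiagonal_eq0 hR) ?mulr0 //; lia.
Qed.

(* Eliminate the entries of L, M and T from the (j,i), (k,j) and (k,i) entries
   of D T = T M and L T = T E. *)
Lemma eigenvalue_gap_relation D E L M T (i j k : 'I_n) : T \in unitmx -> is_trig_mx T ->
  is_diag_mx D -> is_diag_mx E -> lower_bidiagonal L -> lower_bidiagonal M ->
  D *m T = T *m M -> L *m T = T *m E ->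
  j = i.+1 :> nat -> k = j.+1 :> nat -> injective (fun l => E l l) ->
  T j i != 0 -> T k j != 0 ->
  (D k k - D i i) * (E j j - E k k) = (E i i - E k k) * (D j j - D i i).
Proof.
move=> hT tT hD hE hL hM DT LT ji kj.
have T_neq0 l := trig_unitmx_diag_neq0 l tT hT.
have MT_diag l : M l l = D l l.
  have := congr1 (fun M : 'M_n => M l l) DT; rewrite (mulmx_diagl _ _ _ hD) mxE.
  rewrite (sum_supp1 (i := l)) => [|h].
    by rewrite mulrC => /(mulfI (T_neq0 l)) ->.
  rewrite -val_eqE /= => hl.
  have [lt_lh|le_hl] := ltnP l h; first by rewrite (trig_mx_eq0 tT) ?mul0r.
  by rewrite (lower_bidiagonal_eq0 hM) ?mulr0 //; lia.
have LT_diag l : L l l = E l l.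
  have := congr1 (fun M : 'M_n => M l l) LT; rewrite (mulmx_diagr _ _ _ hE) mxE.
  rewrite (sum_supp1 (i := l)) => [|h].
    by rewrite mulrC => /(mulfI (T_neq0 l)).
  rewrite -val_eqE /= => hl.
  have [lt_lh|le_hl] := ltnP h l; first by rewrite (trig_mx_eq0 tT) ?mulr0.
  by rewrite (lower_bidiagonal_eq0 hL) ?mul0r //; lia.
have DTE (l h h' : 'I_n) : h' = h.+1 :> nat -> (D l l - D h h) * T l h = T l h' * M h' h.
  move=> hh'; have := congr1 (fun M : 'M_n => M l h) DT; rewrite (mulmx_diagl _ _ _ hD) mxE.
  rewrite (sum_supp2 (i := h) (j := h')) => [||g]; last 2 first.
  - by rewrite -val_eqE /=; lia.
  - rewrite -!val_eqE /= => gh gh'.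
    by rewrite (lower_bidiagonal_eq0 hM) ?mulr0 //; lia.
  by rewrite MT_diag mulrBl => ->; ring.
have LTE (l' l h : 'I_n) : l = l'.+1 :> nat -> (E h h - E l l) * T l h = L l l' * T l' h.
  move=> ll'; have := congr1 (fun M : 'M_n => M l h) LT; rewrite (mulmx_diagr _ _ _ hE) mxE.
  rewrite (sum_supp2 (i := l) (j := l')) => [||g]; last 2 first.
  - by rewrite -val_eqE /=; lia.
  - rewrite -!val_eqE /= => gh gh'.
    by rewrite (lower_bidiagonal_eq0 hL) ?mul0r //; lia.
  by rewrite LT_diag mulrBl [T l h * _]mulrC => <-; ring.
move=> E_inj Tji Tkj.
have e2 := LTE j k i kj.
have e3 := DTE j i j ji.
have e4 := DTE k i j ji.
have e5 := LTE j k j kj.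
have Lkj : L k j != 0.
  apply: contraNneq Tkj => Lkj; move/eqP: e5.
  rewrite Lkj mul0r mulf_eq0 subr_eq0 => /orP[/eqP/E_inj/(congr1 val)|//] /=.
  by lia.
(* The factor [L k j * T j i] equals [(E i i - E k k) * T k i] by [e2], which brings in the corner
   entry [T k i] that [e4] also controls. *)
apply: (mulIf (mulf_neq0 Lkj Tji)).
transitivity ((D k k - D i i) * (E j j - E k k) * ((E i i - E k k) * T k i)).
  by rewrite e2; ring.
transitivity ((E j j - E k k) * (E i i - E k k) * ((D k k - D i i) * T k i)).
  by ring.
rewrite e4.
transitivity ((E i i - E k k) * M j i * ((E j j - E k k) * T k j)); first by ring.
rewrite e5.
transitivity ((E i i - E k k) * L k j * (T j j * M j i)); first by ring.
by rewrite -e3; ring.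
Qed.

End BandMatrices.

(** * Change of basis and reversal of bases *)

Section BaseChange.
Variables (K : fieldType) (V : vectType K).
Implicit Types (X Y Z : (\dim {:V}).-tuple V) (A B C : 'End(V)).

(** Column [j] holds the coordinates of the [j]-th vector of [Y] with respect to [X]. For bases,
    lower triangularity therefore says that the final segments of [X] and [Y] span the same flag. *)
Definition base_change X Y : 'M[K]_(\dim {:V}) := (passmx.mxof Y X \1%VF)^T.

Lemma rep_mxE X A i j : rep_mx X A i j = coord X i (A X`_j).
Proof. by rewrite !mxE /= passmx.vecof_delta. Qed.

Lemma base_changeE X Y i j : base_change X Y i j = coord X i Y`_j.
Proof. by rewrite !mxE /= passmx.vecof_delta lfunE. Qed.

Lemma rep_mx_base_change X Y A : basis_of fullv X -> basis_of fullv Y ->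
  rep_mx X A *m base_change X Y = base_change X Y *m rep_mx Y A.
Proof.
move=> hX hY; rewrite -!trmx_mul -!passmx.mxof_comp //.
by rewrite comp_lfun1l comp_lfun1r.
Qed.

Lemma base_change_comp X Y Z :
  basis_of fullv X -> basis_of fullv Y -> basis_of fullv Z ->
  base_change X Y *m base_change Y Z = base_change X Z.
Proof.
by move=> hX hY hZ; rewrite -trmx_mul -passmx.mxof_comp // comp_lfun1l.
Qed.

Lemma base_changeK X Y : basis_of fullv X -> basis_of fullv Y ->
  base_change X Y *m base_change Y X = 1%:M.
Proof.
move=> hX hY; rewrite base_change_comp // /base_change.
by rewrite passmx.mxof1 ?trmx1 ?(basis_free hX).
Qed.

Lemma base_change_unit X Y : basis_of fullv X -> basis_of fullv Y ->
  base_change X Y \in unitmx.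
Proof. by move=> hX hY; have [] := mulmx1_unit (base_changeK hX hY). Qed.

Lemma base_change_trigV X Y : basis_of fullv X -> basis_of fullv Y ->
  is_trig_mx (base_change X Y) -> is_trig_mx (base_change Y X).
Proof. by move=> hX hY /trig_mx_inverse; apply; apply: base_changeK. Qed.

Definition rev_basis X : (\dim {:V}).-tuple V := [tuple of rev X].

Lemma nth_rev_basis X (i : 'I_(\dim {:V})) : (rev_basis X)`_i = X`_(rev_ord i).
Proof. by rewrite nth_rev size_tuple. Qed.

Lemma rev_basis_basis X : basis_of fullv X -> basis_of fullv (rev_basis X).
Proof. by rewrite (perm_basis _ (permEl (perm_rev X))). Qed.

Lemma coord_rev_basis X i v : basis_of fullv X ->
  coord (rev_basis X) i v = coord X (rev_ord i) v.
Proof.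
move=> hX; have hrX := rev_basis_basis hX.
rewrite [in LHS](coord_basis hX (memvf v)) (reindex_inj rev_ord_inj) /=.
under eq_bigr => j _ do rewrite -nth_rev_basis.
by rewrite coord_sum_free ?(basis_free hrX).
Qed.

Lemma rep_mx_rev_basis X A i j : basis_of fullv X ->
  rep_mx (rev_basis X) A i j = rep_mx X A (rev_ord i) (rev_ord j).
Proof. by move=> hX; rewrite !rep_mxE coord_rev_basis // nth_rev_basis. Qed.

Lemma base_change_rev_basis X Y i j :
  base_change X (rev_basis Y) i j = base_change X Y i (rev_ord j).
Proof. by rewrite !base_changeE nth_rev_basis. Qed.

(** Reversal exchanges the subdiagonal and the superdiagonal. This absorbs the reversed case of
    [split_basis_alignment]. *)
Lemma fst_standard_rev_basis (P : 'End(V) * 'End(V)) X :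
  fst_standard P X -> fst_standard P (rev_basis X).
Proof.
case=> hX /is_diag_mxP hD [hR hRl hRu]; split; first exact: rev_basis_basis.
  apply/is_diag_mxP => i j ij; rewrite rep_mx_rev_basis //; apply: hD.
  by apply: contra ij => /eqP/val_inj/rev_ord_inj ->.
split=> i j; rewrite rep_mx_rev_basis //; have := ltn_ord i; have := ltn_ord j.
- move=> jn im /hR /= [] e; [apply: Or31|apply: Or33|apply: Or32]; lia.
- by move=> jn im ij; apply: hRu => /=; lia.
- by move=> jn im ij; apply: hRl => /=; lia.
Qed.

End BaseChange.

(** * Adjacent Leonard pairs and their eigenvalue gaps *)

Section AdjacentLeonardPairs.
Variables (K : fieldType) (V : vectType K).
Implicit Types (X Y Z : (\dim {:V}).-tuple V) (A B C : 'End(V)).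
Implicit Types P Q : 'End(V) * 'End(V).

Lemma Leonard_pair_swap A As : Leonard_pair (A, As) -> Leonard_pair (As, A).
Proof. by case. Qed.

Lemma standard_swap A As X : standard (A, As) X -> standard (As, A) X.
Proof. by case; [right|left]. Qed.

Lemma split_basis_swap A As X : split_basis (A, As) X -> split_basis (As, A) X.
Proof. by case=> hX [h|h]; split=> //; [right|left]. Qed.

Lemma adjacent_sym P Q : adjacent P Q -> adjacent Q P.
Proof. by case. Qed.

Lemma adjacent_swapr P B Bs : adjacent P (B, Bs) -> adjacent P (Bs, B).
Proof.
case=> hPB hBP; split=> X.
  by move=> /hPB/split_basis_swap.
by move=> /standard_swap/hBP.
Qed.

(** In the other kind of standard basis [P.1] is irreducible tridiagonal, and the base change to [X]
    diagonalizes it, so its eigenvalues are simple. *)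
Lemma Leonard_pair_eigenvalues_inj P X : Leonard_pair P -> fst_standard P X ->
  injective (fun i => rep_mx X P.1 i i).
Proof.
case=> _ [Y [hY _ hR]] [hX hD _].
apply: (irreducible_tridiagonal_simple hR (base_change_unit hY hX) hD).
exact: rep_mx_base_change.
Qed.

Lemma aligned_standard_basis Q X : Leonard_pair Q -> basis_of fullv X ->
  lower_bidiagonal (rep_mx X Q.1) -> upper_bidiagonal (rep_mx X Q.2) ->
  exists2 Y, fst_standard Q Y & is_trig_mx (base_change X Y).
Proof.
move=> hQ hX hL hU; have [[Y stY] _] := hQ.
have [hY hD hR] := stY.
have [tT|T0] := split_basis_alignment (base_change_unit hX hY) hL hU hD
  (Leonard_pair_eigenvalues_inj hQ stY) hR
  (rep_mx_base_change _ hX hY) (rep_mx_base_change _ hX hY).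
  by exists Y.
exists (rev_basis Y); first exact: fst_standard_rev_basis.
apply/is_trig_mxP => i j ij; rewrite base_change_rev_basis T0 //.
by rewrite rev_ordK.
Qed.

(** Adjacency leaves open which member of [Q] is lower bidiagonal in [X]. It cannot be [Q.2]: that
    map is irreducible tridiagonal in [Y], and [Y] has the same flag as [X]. *)
Lemma split_aligned P Q X Y (i j : 'I_(\dim {:V})) :
  adjacent P Q -> fst_standard P X -> fst_standard Q Y ->
  is_trig_mx (base_change X Y) -> j = i.+1 :> nat ->
  lower_bidiagonal (rep_mx X Q.1) /\ upper_bidiagonal (rep_mx X Q.2).
Proof.
case=> hPQ _ stX [hY _ hR] tT ji.
have [hX [//|[hL _]]] := hPQ X (or_introl stX).
by case: (trig_not_lower_bidiagonal (base_change_unit hX hY) tT hL hR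
  (rep_mx_base_change _ hX hY) ji).
Qed.

(** Both directions of adjacency enter: [X] is split for [Q] and [Y] is split for [P], which makes
    each of [P.1] and [Q.1] lower bidiagonal in the eigenbasis of the other. *)
Lemma adjacent_gap_relation P Q X Y (i j k : 'I_(\dim {:V})) :
  Leonard_pair Q -> adjacent P Q ->
  fst_standard P X -> fst_standard Q Y -> is_trig_mx (base_change X Y) ->
  j = i.+1 :> nat -> k = j.+1 :> nat ->
  let th l := rep_mx X P.1 l l in let et l := rep_mx Y Q.1 l l in
  (th k - th i) * (et j - et k) = (et i - et k) * (th j - th i).
Proof.
move=> hQ hPQ stX stY tXY ji kj /=.
have [hX hD _] := stX; have [hY hE hR] := stY.
have [hL hU] := split_aligned hPQ stX stY tXY ji.
have tYX := base_change_trigV hX hY tXY.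
have [hM _] := split_aligned (adjacent_sym hPQ) stY stX tYX ji.
have uXY := base_change_unit hX hY.
have E_inj := Leonard_pair_eigenvalues_inj hQ stY.
apply: (eigenvalue_gap_relation uXY tXY hD hE hL hM) => //;
  try exact: rep_mx_base_change.
  by apply: (split_trig_subdiagonal_neq0 uXY tXY hL hU hE E_inj hR) => //;
    exact: rep_mx_base_change.
by apply: (split_trig_subdiagonal_neq0 uXY tXY hL hU hE E_inj hR) => //;
  exact: rep_mx_base_change.
Qed.

(* The gap ratios a'/a, b'/b, c'/c of three sequences whose pairwise products
   are 1 are all 1 or all -1, and -1 is excluded by a + a' != 0. *)
Lemma pairwise_inverse_ratios (a a' b b' c c' : K) :
  a != 0 -> b != 0 -> c != 0 -> c + c' != 0 ->
  a' * b' = a * b -> a' * c' = a * c -> b' * c' = b * c -> a' = a.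
Proof.
move=> a0 b0 c0 cc' ab ac bc.
have : (c - c') * (c + c') * (a * b) = 0.
  have -> : (c - c') * (c + c') * (a * b) = (a * c) * (b * c) - c' * c' * (a * b).
    by ring.
  by rewrite -ac -bc -ab; ring.
move/eqP; rewrite !mulf_eq0 (negPf a0) (negPf b0) (negPf cc') !orbF.
by move=> /eqP/subr0_eq cE; move: ac; rewrite -cE => /(mulIf c0).
Qed.

Lemma eigenvalue_gaps_eq_aligned P Q R X Y Z (i j k : 'I_(\dim {:V})) :
  Leonard_pair P -> Leonard_pair Q -> Leonard_pair R ->
  adjacent P Q -> adjacent P R -> adjacent Q R ->
  fst_standard P X -> fst_standard Q Y -> fst_standard R Z ->
  is_trig_mx (base_change X Y) -> is_trig_mx (base_change X Z) ->
  j = i.+1 :> nat -> k = j.+1 :> nat ->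
  let th l := rep_mx X P.1 l l in th k - th j = th j - th i.
Proof.
move=> hP hQ hR hPQ hPR hQR stX stY stZ tXY tXZ ji kj /=.
have [hX _ _] := stX; have [hY _ _] := stY; have [hZ _ _] := stZ.
(* [Y] and [Z] both share the flag of [X], hence share it with each other. *)
have tYZ : is_trig_mx (base_change Y Z).
  by rewrite -(base_change_comp hY hX hZ) mulmx_trig // base_change_trigV.
have ePQ := adjacent_gap_relation hQ hPQ stX stY tXY ji kj.
have ePR := adjacent_gap_relation hR hPR stX stZ tXZ ji kj.
have eQR := adjacent_gap_relation hR hQR stY stZ tYZ ji kj.
have neq P' X' (l l' : 'I_(\dim {:V})) : Leonard_pair P' -> fst_standard P' X' ->
    l <> l' :> nat -> rep_mx X' P'.1 l l - rep_mx X' P'.1 l' l' != 0.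
  move=> hP' stX' ll'; rewrite subr_eq0; apply/eqP.
  by move/(Leonard_pair_eigenvalues_inj hP' stX')/(congr1 val).
move: ePQ ePR eQR (neq _ _ j i hP stX) (neq _ _ j i hQ stY) (neq _ _ j i hR stZ) (neq _ _ k i hR stZ).
rewrite /=; set t0 := rep_mx X _ i i; set t1 := rep_mx X _ j j; set t2 := rep_mx X _ k k.
set x0 := rep_mx Y _ i i; set x1 := rep_mx Y _ j j; set x2 := rep_mx Y _ k k.
set z0 := rep_mx Z _ i i; set z1 := rep_mx Z _ j j; set z2 := rep_mx Z _ k k.
move=> e1 e2 e3 n1 n2 n3 n4.
(* Rewritten in terms of consecutive gaps, the relation says that the two gap ratios are inverse to
   each other. *)
have gap (p0 p1 p2 q0 q1 q2 : K) : (p2 - p0) * (q1 - q2) = (q0 - q2) * (p1 - p0) ->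
    (p2 - p1) * (q2 - q1) = (p1 - p0) * (q1 - q0).
  move=> e; apply/eqP; rewrite -subr_eq0; apply/eqP.
  transitivity ((q0 - q2) * (p1 - p0) - (p2 - p0) * (q1 - q2)); first by ring.
  by rewrite e subrr.
apply: (@pairwise_inverse_ratios _ _ (x1 - x0) (x2 - x1) (z1 - z0) (z2 - z1)).
- by apply: n1; lia.
- by apply: n2; lia.
- by apply: n3; lia.
(* The sum of the two gaps telescopes to [z2 - z0], a difference of distinct eigenvalues. *)
- by rewrite addrC subrKA; apply: n4; lia.
- exact: gap.
- exact: gap.
- exact: gap.
Qed.

Lemma eigenvalue_gaps_eq P B Bs C Cs X (i j k : 'I_(\dim {:V})) :
  Leonard_pair P -> Leonard_pair (B, Bs) -> Leonard_pair (C, Cs) ->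
  adjacent P (B, Bs) -> adjacent P (C, Cs) -> adjacent (B, Bs) (C, Cs) ->
  fst_standard P X -> j = i.+1 :> nat -> k = j.+1 :> nat ->
  let th l := rep_mx X P.1 l l in th k - th j = th j - th i.
Proof.
move=> hP hB hC hPB hPC hBC stX ji kj /=.
(* Being a Leonard pair and being adjacent are both insensitive to swapping [B] and [Bs], so the
   lower bidiagonal member may be named [B]. *)
wlog [hBL hBU] : B Bs hB hPB hBC /
    lower_bidiagonal (rep_mx X B) /\ upper_bidiagonal (rep_mx X Bs).
  move=> wl; have [hX [h|h]] := hPB.1 X (or_introl stX); first exact: (wl B Bs).
  apply: (wl Bs B) => //; first exact: Leonard_pair_swap.
    exact: adjacent_swapr.
  by apply/adjacent_sym/adjacent_swapr/adjacent_sym.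
wlog [hCL hCU] : C Cs hC hPC hBC /
    lower_bidiagonal (rep_mx X C) /\ upper_bidiagonal (rep_mx X Cs).
  move=> wl; have [hX [h|h]] := hPC.1 X (or_introl stX); first exact: (wl C Cs).
  apply: (wl Cs C) => //; first exact: Leonard_pair_swap.
    exact: adjacent_swapr.
  exact: adjacent_swapr.
have [hX _ _] := stX.
have [Y stY tXY] := aligned_standard_basis hB hX hBL hBU.
have [Z stZ tXZ] := aligned_standard_basis hC hX hCL hCU.
exact: (eigenvalue_gaps_eq_aligned hP hB hC hPB hPC hBC stX stY stZ).
Qed.

Lemma arithmetic_of_gaps n (theta : 'I_n -> K) : injective theta ->
  (forall i j k : 'I_n, j = i.+1 :> nat -> k = j.+1 :> nat ->
    theta k - theta j = theta j - theta i) ->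
  arithmetic theta.
Proof.
move=> th_inj gaps; split=> //.
(* With fewer than two terms there is no gap to serve as [alpha], so the nonzero scalar 1 is
   taken. *)
case: n => [|[|n]] in theta th_inj gaps *.
- by exists 1, 0; split=> [|[]//]; rewrite oner_neq0.
- exists 1, (theta ord0); split=> [|i]; first by rewrite oner_neq0.
  by rewrite (ord1 i) mulr0 add0r.
pose f m := theta (inord m).
have step m : (m.+1 < n.+2)%N -> f m.+1 - f m = f 1%N - f 0%N.
  elim: m => // m IH mn; rewrite -IH ?(ltnW mn) //.
  by apply: gaps; rewrite !inordK //; lia.
exists (f 1%N - f 0%N), (f 0%N); split.
  rewrite subr_eq0; apply/eqP => /th_inj/(congr1 val).
  by rewrite /= !inordK.
move=> i; rewrite -[theta i]/(theta i) -[in theta i](inord_val i) -/(f i).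
elim: (i : nat) (ltn_ord i) => [|m IH] mn; first by rewrite mulr0 add0r.
by rewrite -[LHS](subrK (f m)) step // IH ?(ltnW mn) // -natr1; ring.
Qed.

Lemma eigenvalue_seq_arithmetic A As B Bs C Cs (theta : 'I_(\dim {:V}) -> K) :
  Leonard_pair (A, As) -> Leonard_pair (B, Bs) -> Leonard_pair (C, Cs) ->
  adjacent (A, As) (B, Bs) -> adjacent (A, As) (C, Cs) ->
  adjacent (B, Bs) (C, Cs) ->
  eigenvalue_seq (A, As) theta \/ dual_eigenvalue_seq (A, As) theta ->
  arithmetic theta.
Proof.
move=> hA hB hC hAB hAC hBC.
(* A dual eigenvalue sequence of [(A, As)] is an eigenvalue sequence of [(As, A)], which satisfies
   the same hypotheses. *)
wlog [X stX AX] : A As hA hAB hAC / eigenvalue_seq (A, As) theta.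
  move=> wl [h|h]; first by apply: (wl A As) => //; left.
  apply: (wl As A) => //; last by left.
  - exact: Leonard_pair_swap.
  - by apply/adjacent_sym/adjacent_swapr/adjacent_sym.
  - by apply/adjacent_sym/adjacent_swapr/adjacent_sym.
move=> _; have [hX _ _] := stX.
have thE i : rep_mx X A i i = theta i.
  rewrite rep_mxE -tnth_nth AX linearZ /= (tnth_nth 0).
  by rewrite coord_free ?(basis_free hX) // eqxx mulr1.
apply: arithmetic_of_gaps.
  move=> i j; rewrite -!thE.
  exact: (Leonard_pair_eigenvalues_inj hA stX).
move=> i j k ji kj; rewrite -!thE.
exact: (eigenvalue_gaps_eq hA hB hC hAB hAC hBC stX ji kj).
Qed.

End AdjacentLeonardPairs.

Theorem theorem7p1 (K : fieldType) (hK : [pchar K] =i pred0)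
    (V : vectType K) (hV : (0 < \dim {:V})%N)
    (A As B Bs C Cs : 'End(V))
    (hA : Leonard_pair (A, As)) (hB : Leonard_pair (B, Bs))
    (hC : Leonard_pair (C, Cs))
    (hAB : adjacent (A, As) (B, Bs)) (hAC : adjacent (A, As) (C, Cs))
    (hBC : adjacent (B, Bs) (C, Cs)) :
  [/\ forall theta : 'I_(\dim {:V}) -> K,
        eigenvalue_seq (A, As) theta \/ dual_eigenvalue_seq (A, As) theta ->
        arithmetic theta,
      forall theta : 'I_(\dim {:V}) -> K,
        eigenvalue_seq (B, Bs) theta \/ dual_eigenvalue_seq (B, Bs) theta ->
        arithmetic theta
    & forall theta : 'I_(\dim {:V}) -> K,
        eigenvalue_seq (C, Cs) theta \/ dual_eigenvalue_seq (C, Cs) theta ->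
        arithmetic theta].
Proof.
have hBA := adjacent_sym hAB; have hCA := adjacent_sym hAC.
have hCB := adjacent_sym hBC.
split=> theta.
- exact: (eigenvalue_seq_arithmetic hA hB hC).
- exact: (eigenvalue_seq_arithmetic hB hA hC).
- exact: (eigenvalue_seq_arithmetic hC hA hB).
Qed.
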